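(* Let $G$ be a finite simple connected graph with minimum degree $\delta(G)=2$ such that the value $W(G\setminus v)$ is the same for all $v\in V(G)$. Then $G$ is a cycle.
   Context: For a graph $G=(V,E)$, $d_G(u,v)$ denotes the length of a shortest path between $u$ and $v$, and the total distance (Wiener index) $W(G)$ is the sum of $d_G(u,v)$ over all unordered pairs of vertices $\{u,v\}\subseteq V$. $G\setminus v$ is the graph obtained from $G$ by deleting the vertex $v$ and its incident edges. The distance between vertices in different components is $\infty$, so $W$ of a disconnected graph is $+\infty$. $\delta(G)$ is the minimum degree of $G$. *)

(* Defs.v *)
From HB Require Import structures.
From mathcomp Require Import all_boot all_order all_algebra.
From mathcomp Require Import constructive_ereal.
Set Implicit Arguments.
Unset Strict Implicit.
Unset Printing Implicit Defensive.

Record sgraph := SGraph {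
  vertex :> finType;
  adj : rel vertex;
  adj_sym : symmetric adj;
  adj_irrefl : irreflexive adj }.

Section Graph.
Variable G : sgraph.

Definition is_connected : Prop :=
  0 < #|G| /\ forall x y : G, connect (@adj G) x y.

Definition degree (x : G) : nat := #|[set y | adj x y]|.

(* Degrees are smaller than #|G|, so the default value #|G| does not affect
   the minimum when G is nonempty. *)
Definition min_degree : nat := \big[minn/#|G|]_(x : G) degree x.

Definition has_walk (x y : G) (n : nat) : bool :=
  [exists p : n.-tuple G, path (@adj G) x p && (last x p == y)].

Lemma connect_has_walk (x y : G) :
  connect (@adj G) x y -> exists n, has_walk x y n.
Proof.
case/connectP=> p xp ->; exists (size p).
by apply/existsP; exists (in_tuple p); rewrite xp eqxx.
Qed.

(* A shortest walk is a path, so the least length of a walk is the distance. *)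
Definition dist (x y : G) : \bar int :=
  if @idP (connect (@adj G) x y) is ReflectT xy
  then (Posz (ex_minn (connect_has_walk xy)))%:E
  else +oo%E.

(* Each unordered pair {x, y} of distinct vertices is listed once, in the
   order of the enumeration of the vertices; dist is symmetric. *)
Definition wiener : \bar int :=
  (\sum_(x : G) \sum_(y : G | (enum_rank x < enum_rank y)%N) dist x y)%E.

Definition del_vertex (v : G) : sgraph :=
  @SGraph {x : G | x != v} (relpre val (@adj G))
    (fun x y => adj_sym (val x) (val y)) (fun x => adj_irrefl (val x)).

(* G is isomorphic to the graph on 'I_n, n >= 3, in which i is adjacent to
   i + 1 mod n. *)
Definition is_cycle : Prop :=
  exists n, 3 <= n /\ exists f : G -> 'I_n, bijective f /\
    forall x y : G,
      adj x y = (f y == ordS (f x)) || (f x == ordS (f y)).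

End Graph.

(* Main.v *)
Require Import Defs.
From mathcomp Require Import all_boot all_order all_algebra.
From mathcomp Require Import constructive_ereal.
From mathcomp Require Import zify.

(** Deleting a farthest vertex from some root leaves a connected graph, so the
    common value of W(G \ x) is finite, and hence no vertex is a cut vertex.
    Let n be the order of G, v a vertex of degree 2, and u, w its neighbours.
    In G \ u the vertex v is pendant at w, so
      W(G \ u) = W(G \ {u, v}) + sum over x of (1 + d_{G \ {u, v}}(w, x)),
    with x ranging over the n - 2 vertices other than u and v.  In G \ v,
    distances can only be smaller than in G \ {u, v}, so
      W(G \ v) <= W(G \ {u, v}) + sum over x of d_{G \ v}(u, x).
    As the two left-hand sides agree, writing D(z) for the total distance from
    z in G \ v, we get n - 2 + D(w) - d_{G \ v}(u, w) <= D(u)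
    (pendant_compare).  Exchanging u and w and adding the two inequalities, D
    cancels and n - 2 <= d_{G \ v}(u, w) is left (nbrs_far_apart).  But G \ v
    has n - 1 vertices, so a shortest path from u to w visits all of them and,
    being shortest, has no chord; closing it through v gives the whole of G
    (far_apart_cycle).

    Distances are handled as natural numbers attached to relations on one fixed
    vertex type, so that G, G \ v and G \ {u, v} have the same points and can
    be compared directly; the last part transfers the extended-integer Wiener
    index of the subtype graph G \ v to this setting. *)

Set Implicit Arguments.
Unset Strict Implicit.
Unset Printing Implicit Defensive.

(** * Distances for a relation on a finite type *)

Section Distance.
Variable T : finType.
Implicit Types (e : rel T) (x y z : T).

Definition walk e x y (n : nat) : bool :=
  [exists p : n.-tuple T, path e x p && (last x p == y)].

(** For disconnected points this is #|T|, which exceeds the length of every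
    shortest path.  With this value, the triangle inequality and the
    monotonicity lemmas hold without any connectivity hypothesis. *)
Definition gdist e x y : nat := find (walk e x y) (iota 0 #|T|).

Lemma walkP e x y n :
  reflect (exists p, [/\ path e x p, last x p = y & size p = n]) (walk e x y n).
Proof.
apply: (iffP existsP) => [[p /andP[xp /eqP lp]]|[p [xp lp sp]]].
  by exists p; split; rewrite ?size_tuple.
by exists (Tuple (introT eqP sp)); rewrite xp lp eqxx.
Qed.

Lemma gdist_walk e x y n : walk e x y n -> gdist e x y <= n.
Proof.
move=> wn; case: (leqP #|T| n) => [le_n|lt_n].
  by apply: leq_trans le_n; rewrite -[#|T|](size_iota 0) find_size.
rewrite leqNgt; apply/negP=> /(before_find 0).
by rewrite nth_iota // add0n wn.
Qed.

Lemma gdist_path e x p : path e x p -> gdist e x (last x p) <= size p.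
Proof. by move=> xp; apply/gdist_walk/walkP; exists p. Qed.

Lemma geodesic e x y : connect e x y ->
  exists p, [/\ path e x p, last x p = y, uniq (x :: p) & size p = gdist e x y].
Proof.
move=> /connectP[p0 xp0 ->].
have [n] : exists n, walk e x (last x p0) n && (n < #|T|).
  case/shortenP: xp0 => p xp Up _; exists (size p).
  rewrite -[(size p).+1]/(size (x :: p)) -(card_uniqP Up) max_card andbT.
  by apply/walkP; exists p.
case/andP=> wn ltn; have: has (walk e x (last x p0)) (iota 0 #|T|).
  by apply/hasP; exists n; rewrite // mem_iota.
move=> /[dup] hw /(nth_find 0); rewrite has_find size_iota in hw.
rewrite nth_iota // add0n -/(gdist e x (last x p0)) => /walkP[p [xp lp sp]].
rewrite -lp in sp *.
case/shortenP: xp sp => q xq Uq /(uniq_leq_size (proj2 (andP Uq))) le_qp sp.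
exists q; split=> //; apply/eqP; rewrite eqn_leq gdist_path // andbT.
by rewrite -sp.
Qed.

Lemma gdist_disconnected e x y : ~~ connect e x y -> gdist e x y = #|T|.
Proof.
move=> nc; rewrite /gdist hasNfind ?size_iota //.
apply/hasPn=> n _; apply/negP=> /walkP[p [xp lp _]].
by case/negP: nc; apply/connectP; exists p.
Qed.

Lemma gdist_le_card e x y : gdist e x y <= #|T|.
Proof. by rewrite -[#|T|](size_iota 0) find_size. Qed.

Lemma gdist0 e x : gdist e x x = 0.
Proof. by apply/eqP; rewrite -leqn0; exact: (@gdist_path e x [::]). Qed.

Lemma gdist_eq0 e x y : connect e x y -> gdist e x y = 0 -> x = y.
Proof. by move=> /geodesic[[|z p] [//= _ <- _ <-]]. Qed.

Lemma gdist_triangle e x y z : gdist e x z <= gdist e x y + gdist e y z.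
Proof.
case: (boolP (connect e x y)) => [cxy|/gdist_disconnected->]; last first.
  exact/(leq_trans (gdist_le_card e x z))/leq_addr.
case: (boolP (connect e y z)) => [cyz|/gdist_disconnected->]; last first.
  exact/(leq_trans (gdist_le_card e x z))/leq_addl.
have [p [xp lp _ <-]] := geodesic cxy; have [q [yq lq _ <-]] := geodesic cyz.
rewrite -size_cat; apply/gdist_walk/walkP; exists (p ++ q).
by rewrite cat_path last_cat lp xp.
Qed.

Lemma gdist_edge e x y : e x y -> gdist e x y <= 1.
Proof. by move=> exy; apply: (@gdist_path e x [:: y]); rewrite /= exy. Qed.

Lemma gdist_first_step e x y : connect e x y -> x != y ->
  exists2 z, e x z & gdist e z y < gdist e x y.
Proof.
move=> /geodesic[[|z p] [/= xp lp _ <-]]; first by rewrite lp eqxx.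
by case/andP: xp => exz zp _; exists z; rewrite // ltnS -lp gdist_path.
Qed.

End Distance.

(** Collapsed edges are allowed so that folding a pendant vertex onto its
    neighbour is covered, besides inclusions between relations and the passage
    to or from a subtype of the points. *)
Lemma path_map_lazy (T T' : finType) (e : rel T) (e' : rel T') (f : T -> T') :
    (forall x y, e x y -> f x = f y \/ e' (f x) (f y)) ->
  forall p x, path e x p -> connect e' (f x) (f (last x p)) /\
                            gdist e' (f x) (f (last x p)) <= size p.
Proof.
move=> fe; elim=> [|y p IHp] x /=; first by rewrite gdist0 connect0.
case/andP=> /fe e'xy /IHp[c d]; case: e'xy => [->|e'xy].
  by split=> //; lia.
split; first exact: connect_trans (connect1 e'xy) c.
have := gdist_triangle e' (f x) (f y) (f (last y p)).
have := gdist_edge e'xy; lia.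
Qed.

Lemma gdist_map (T T' : finType) (e : rel T) (e' : rel T') (f : T -> T') x y :
    (forall a b, e a b -> f a = f b \/ e' (f a) (f b)) -> connect e x y ->
  connect e' (f x) (f y) /\ gdist e' (f x) (f y) <= gdist e x y.
Proof.
by move=> fe /geodesic[p [xp <- _ <-]]; apply: path_map_lazy xp.
Qed.

Lemma gdist_contract (T : finType) (e e' : rel T) (f : T -> T) x y :
    (forall a b, e a b -> f a = f b \/ e' (f a) (f b)) ->
  gdist e' (f x) (f y) <= gdist e x y.
Proof.
move=> fe; case: (boolP (connect e x y)) => [c|/gdist_disconnected->].
  by case: (gdist_map fe c).
exact: gdist_le_card.
Qed.

Lemma gdist_sub (T : finType) (e e' : rel T) x y :
  subrel e' e -> gdist e x y <= gdist e' x y.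
Proof. by move=> s; apply: (@gdist_contract _ e' e id) => a b /s; right. Qed.

Lemma gdist_sym (T : finType) (e : rel T) :
  symmetric e -> forall x y, gdist e x y = gdist e y x.
Proof.
move=> es; suff le x y : gdist e x y <= gdist e y x.
  by move=> x y; apply/eqP; rewrite eqn_leq !le.
case: (boolP (connect e y x)) => [|/gdist_disconnected->]; last first.
  exact: gdist_le_card.
case/geodesic=> p [yp lp _ <-]; apply/gdist_walk/walkP.
exists (rev (belast y p)); rewrite size_rev size_belast -lp rev_path.
split=> //; first by rewrite (eq_path (e' := e)) // => a b; rewrite es.
by case: p {yp lp} => //= a p; rewrite rev_cons last_rcons.
Qed.

(** * Deleting a vertex *)

(** The deleted vertex is kept as an isolated point, so that deletions of
    different vertices are relations on the same type. *)
Definition del (T : finType) (e : rel T) (v : T) : rel T :=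
  [rel x y | [&& e x y, x != v & y != v]].

Lemma del_sym (T : finType) (e : rel T) v : symmetric e -> symmetric (del e v).
Proof. by move=> es x y; rewrite /del /= es [(x != v) && _]andbC. Qed.

Section DoubleSums.
Variables (T : finType) (d : T -> T -> nat).
Hypotheses (dC : forall x y, d x y = d y x) (d0 : forall x, d x x = 0).

(** The wiener index sums over unordered pairs, which are listed by an injective
    ranking; sums over ordered pairs are easier to split by vertices. *)
Lemma double_sum_pairs (r : T -> nat) : injective r ->
  \sum_x \sum_y d x y = (\sum_x \sum_(y | r x < r y) d x y).*2.
Proof.
move=> r_inj; rewrite -addnn.
rewrite [X in _ + X](exchange_big_dep xpredT) //= -big_split /=.
apply: eq_bigr => x _; rewrite [X in X + _]big_mkcond [X in _ + X]big_mkcond.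
rewrite -big_split; apply: eq_bigr => y _ /=.
by rewrite [d y x]dC; case: (ltngtP (r x) (r y)) => [||/r_inj->];
  rewrite ?addn0 ?d0.
Qed.

Lemma double_sum_split (P : pred T) v : P v ->
  \sum_(x | P x) \sum_(y | P y) d x y =
    \sum_(x | P x && (x != v)) \sum_(y | P y && (y != v)) d x y +
    (\sum_(x | P x && (x != v)) d v x).*2.
Proof.
move=> Pv; rewrite (bigD1 v) //= (bigD1 v Pv) /= d0 add0n.
under [X in _ + X]eq_bigr => x _ do rewrite (bigD1 v Pv) /= dC.
by rewrite big_split -addnn /=; lia.
Qed.

End DoubleSums.

(** Twice the Wiener index of the graph without v, as each pair is counted in
    both orders. *)
Definition double_wiener_del (T : finType) (e : rel T) (v : T) : nat :=
  \sum_(x | x != v) \sum_(y | y != v) gdist (del e v) x y.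

Definition noncut (T : finType) (e : rel T) (v : T) : Prop :=
  forall x y, x != v -> y != v -> connect (del e v) x y.

(** A vertex v farthest from a root r is not a cut vertex: if a shortest path
    from r to another vertex passed through v, that vertex would be farther from
    r than v. *)
Lemma noncut_exists (T : finType) (e : rel T) (r : T) : symmetric e ->
  (exists x, x != r) -> (forall x y, connect e x y) -> exists v, noncut e v.
Proof.
move=> es [s sr] conn; pose v := [arg max_(x > r) gdist e r x].
have vmax x : gdist e r x <= gdist e r v.
  by rewrite /v; case: arg_maxnP => // i _ /(_ x); apply.
have vr : v != r.
  apply: contra_neq sr => vr; apply/esym/(gdist_eq0 (conn r s))/eqP.
  by rewrite -leqn0; have := vmax s; rewrite vr gdist0.
clearbody v; exists v => x y; have to_r z : z != v -> connect (del e v) r z.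
  move=> zv; have [p [rp lp Up sp]] := geodesic (conn r z).
  have vp : v \notin p.
    apply/negP=> vp; move: rp lp sp; case/splitPr: vp => p1 p2.
    rewrite cat_path last_cat /= => /and3P[rp1 e1 _] lp2.
    have := @gdist_path _ e r (rcons p1 v).
    rewrite rcons_path rp1 e1 last_rcons size_rcons size_cat /= => /(_ isT).
    case: p2 lp2 => [/= vz|a p2 _ /=]; first by rewrite vz eqxx in zv.
    have := vmax z; lia.
  apply/connectP; exists p => //; have: all (predC1 v) (r :: p).
    by apply/allP=> t /=; rewrite inE => /orP[/eqP->|tp];
       [rewrite eq_sym | apply: contraNneq vp => <-].
  elim: p r rp {lp Up sp vp vmax vr sr} => //= a p IHp b /andP[eba ap].
  by case/and3P=> bv av pv; rewrite /del /= eba bv av IHp //= av.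
move=> /to_r rx /to_r; apply: connect_trans.
by rewrite (sym_connect_sym (del_sym _ es)).
Qed.

(** * Comparing the deletions of two adjacent vertices *)

Section Compare.
Variables (T : finType) (e : rel T) (v u w : T).
Hypotheses (e_sym : symmetric e) (uv : u != v) (wv : w != v) (wu : w != u).
Hypothesis e_v : forall y, e v y = (y == u) || (y == w).

Let D x : nat := \sum_(y | y != v) gdist (del e v) x y.

(** Both double sums are split into the pairs avoiding u and v, and the pairs
    containing the one of u and v that remains.  Folding v onto w turns walks of
    G \ u into walks of G \ {u, v}; this shows that the pairs avoiding u and v
    contribute at least as much in G \ u as in G \ v, and that v is one step
    farther than w from all other points of G \ u. *)
Lemma pendant_compare :
    noncut e u -> double_wiener_del e u = double_wiener_del e v ->
  D w + #|T| <= D u + gdist (del e v) u w + 2.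
Proof.
move=> u_noncut; have vu : v != u by rewrite eq_sym.
have symu := gdist_sym (del_sym u e_sym).
have symv := gdist_sym (del_sym v e_sym).
rewrite /double_wiener_del (double_sum_split symu (fun=> gdist0 _ _) vu).
rewrite (double_sum_split symv (fun=> gdist0 _ _) uv) => eqW.
pose f x := if x == v then w else x.
have f_contr a b : del e u a b -> f a = f b \/ del (del e u) v (f a) (f b).
  case/and3P; rewrite /f; case: (eqVneq a v) => [-> eb _ bu|av eab au bu].
    by move: eb; rewrite e_v (negPf bu) /= => /eqP->; left; case: ifP.
  case: (eqVneq b v) eab => [->|bv eab]; last first.
    by right; rewrite /del /= eab au bu av.
  by rewrite e_sym e_v (negPf au) /= => /eqP->; left.
(* Distances in G \ u dominate those in G \ {u, v} by the folding, and these
   dominate the distances in G \ v, which has all edges of G \ {u, v}. *)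
have inner_ge : \sum_(x | (x != v) && (x != u)) \sum_(y | (y != v) && (y != u))
     gdist (del e v) x y <= \sum_(x | (x != u) && (x != v))
     \sum_(y | (y != u) && (y != v)) gdist (del e u) x y.
  under eq_bigl => x do rewrite andbC.
  apply: leq_sum => x /andP[xu xv]; under eq_bigl => y do rewrite andbC.
  apply: leq_sum => y /andP[yu yv].
  have := gdist_contract x y f_contr; rewrite /f (negPf xv) (negPf yv).
  apply: leq_trans; apply: gdist_sub => a b.
  by rewrite /del /= => /and3P[/and3P[-> _ _] -> ->].
have pendant x : (x != v) && (x != u) ->
    (gdist (del e v) w x).+1 <= gdist (del e u) v x.
  case/andP=> xv xu; have vx : v != x by rewrite eq_sym.
  have [z vz] := gdist_first_step (u_noncut v x vu xu) vx.
  move: vz; rewrite /del /= e_v vu => /andP[+ zu]; rewrite (negPf zu) => /eqP->.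
  apply: leq_ltn_trans; have := gdist_contract w x f_contr.
  rewrite /f (negPf xv) (negPf wv); apply: leq_trans; apply: gdist_sub => a b.
  by rewrite /del /= => /and3P[/and3P[-> _ _] -> ->].
have: \sum_(x | (x != v) && (x != u)) (gdist (del e v) w x).+1 <=
      \sum_(x | (x != v) && (x != u)) gdist (del e v) u x.
  apply: (@leq_trans (\sum_(x | (x != v) && (x != u)) gdist (del e u) v x)).
    exact: leq_sum.
  move: eqW; under [X in _ + X.*2 = _]eq_bigl => x do rewrite andbC.
  move: inner_ge; lia.
rewrite (eq_bigr (fun x => gdist (del e v) w x + 1)) => [|x _]; last first.
  by rewrite addn1.
rewrite big_split sum1_card /=.
have -> : #|[pred x | (x != v) && (x != u)]| = #|T| - 2.
  rewrite -(cardC (pred2 v u)) card2 eq_sym uv addKn.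
  by apply: eq_card => x; rewrite !inE negb_or.
rewrite /D (bigD1 u uv) /= [X in _ <= X + _ + _](bigD1 u uv) /= gdist0.
rewrite [gdist _ w u]symv; lia.
Qed.

End Compare.

(** The two comparisons, for u and for w, bound the difference of the total
    distances from w and from u in opposite directions; their sum only keeps
    the distance between u and w. *)
Lemma nbrs_far_apart (T : finType) (e : rel T) (v u w : T) :
    symmetric e -> u != v -> w != v -> w != u ->
    (forall y, e v y = (y == u) || (y == w)) ->
    (forall x, noncut e x) ->
    (forall x y, double_wiener_del e x = double_wiener_del e y) ->
  #|T| <= gdist (del e v) u w + 2.
Proof.
move=> es uv wv wu ev nc eqW; have uw : u != w by rewrite eq_sym.
have ev' y : e v y = (y == w) || (y == u) by rewrite ev orbC.
have := pendant_compare es uv wv wu ev (nc u) (eqW u v).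
have := pendant_compare es wv uv uw ev' (nc w) (eqW w v).
rewrite [gdist _ w u](gdist_sym (del_sym v es)); lia.
Qed.

(** * A graph with two far apart neighbours is a cycle *)

Lemma ordS_eq n (i j : 'I_n) :
  (j == ordS i) = (j == i.+1 :> nat) || ((i == n.-1 :> nat) && (j == 0 :> nat)).
Proof.
rewrite -val_eqE /=; have := ltn_ord i; have := ltn_ord j.
case: (ltngtP i.+1 n) => [lt|lt|eqn] jn in_; last 1 first.
- by rewrite eqn modnn; lia.
- by rewrite modn_small //; lia.
- by lia.
Qed.

(** A shortest path from u to w in G \ v has at least n - 1 vertices, so it is
    Hamiltonian in G \ v.  The vertices are numbered along the closed walk
    v, u, ..., w. *)
Lemma far_apart_cycle (G : sgraph) (v u w : G) :
    u != v -> w != v -> w != u ->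
    (forall y, adj v y = (y == u) || (y == w)) -> noncut (@adj G) v ->
  #|G| <= gdist (del (@adj G) v) u w + 2 -> is_cycle G.
Proof.
move=> uv wv wu ev nc far; set e' := del _ v in far.
have [p [up lp Up sp]] := geodesic (nc u w uv wv); rewrite -/e' in up sp.
have vp : v \notin u :: p.
  rewrite inE negb_or eq_sym uv /=; apply/negP=> vp; move: up.
  by case/splitPr: vp => p1 p2; rewrite cat_path /= /e' /del /= eqxx !andbF.
pose s := [:: v, u & p]; have Us : uniq s by rewrite cons_uniq vp.
have ss : size s = #|G|.
  by apply/eqP; rewrite eqn_leq -{1}(card_uniqP Us) max_card /= sp -addn2.
have sT x : x \in s.
  have /subset_leqif_cards[] := subsetT [set x in s]; rewrite cardsT cardsE.
  by rewrite (card_uniqP Us) ss eqxx => _ /esym/eqP/setP/(_ x); rewrite !inE.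
have p_gt0 : 0 < size p by case: (p) lp => //= /eqP; rewrite eq_sym (negPf wu).
have adjS i : i.+1 < size s -> adj (nth v s i) (nth v s i.+1).
  case: i => [|i] lt_i /=; first by rewrite ev eqxx.
  have /(pathP v)/(_ i lt_i) := up; by case/and3P.
have dist_le i j : i <= j < size (u :: p) ->
    gdist e' (nth v (u :: p) i) (nth v (u :: p) j) <= j - i.
  case/andP; elim: j => [|j IHj] le_ij lt_j.
    by move: le_ij; rewrite leqn0 => /eqP->; rewrite gdist0.
  case: (ltngtP i j.+1) le_ij => // [lt_ij _|-> _]; last by rewrite gdist0.
  have /(pathP v)/(_ j lt_j)/gdist_edge := up.
  have := gdist_triangle e' (nth v (u :: p) i) (nth v (u :: p) j)
            (nth v (u :: p) j.+1).
  have := IHj lt_ij (ltnW lt_j); rewrite /=; lia.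
(* The path from u to i, the edge from i to j and the path from j to w would
   together be shorter than the distance from u to w if j > i + 1. *)
have no_chord i j : i < j < size (u :: p) ->
    adj (nth v (u :: p) i) (nth v (u :: p) j) -> j = i.+1.
  case/andP=> lt_ij lt_j a_ij; have lt_i := ltn_trans lt_ij lt_j.
  have e_ij : e' (nth v (u :: p) i) (nth v (u :: p) j).
    have not_v k : k < size (u :: p) -> nth v (u :: p) k != v.
      by move=> lt_k; apply/eqP=> kv; case/negP: vp; rewrite -{1}kv mem_nth.
    by apply/and3P; split; [|exact: not_v..].
  have := gdist_edge e_ij; have := dist_le 0 i; have := dist_le j (size p).
  have -> : nth v (u :: p) (size p) = w.
    by rewrite -lp -[size p]/(size (u :: p)).-1 nth_last.
  have := gdist_triangle e' u (nth v (u :: p) i) w.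
  have := gdist_triangle e' (nth v (u :: p) i) (nth v (u :: p) j) w.
  rewrite /= in lt_j lt_i *; move: ss; rewrite /=; lia.
have adj_lt i j : i < j < size s -> adj (nth v s i) (nth v s j) =
    (j == i.+1) || ((i == 0) && (j == (size s).-1)).
  case/andP=> lt_ij lt_j.
  apply/idP/idP => [|/orP[/eqP ej|/andP[/eqP-> /eqP->]]].
  - case: i j lt_ij lt_j => [|i] [|j] //= lt_ij lt_j.
      rewrite ev => /orP[/eqP eu|/eqP ew]; apply/orP; [left|right].
        by rewrite eqSS -(nth_uniq v _ _ Up) //= eu.
      rewrite eqSS -(nth_uniq v _ _ Up) // ew -lp.
      by rewrite -[size p]/(size (u :: p)).-1 nth_last.
    by move=> a_ij; rewrite (no_chord i j) ?eqxx //= -ltnS lt_ij.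
  - by rewrite ej in lt_j *; apply: adjS.
  - by rewrite nth_last /= lp ev eqxx orbT.
have ltx x : index x s < size s by rewrite index_mem.
pose f x := Ordinal (ltx x); have fE x : f x = index x s :> nat by [].
have s3 : 2 < size s by [].
clearbody s; exists (size s); split=> //; exists f; split.
  apply: inj_card_bij => [x y /(congr1 val)|]; last by rewrite card_ord ss.
  by rewrite /= => exy; rewrite -(nth_index v (sT x)) exy nth_index.
move=> x y; rewrite !ordS_eq !fE.
rewrite -{1}(nth_index v (sT x)) -{1}(nth_index v (sT y)).
move: (ltx x) (ltx y); move: (index x s) (index y s) => i j lt_i lt_j.
case: (ltngtP i j) => [lt_ij|lt_ji|->].
- by rewrite adj_lt ?lt_ij //; move: (size s) lt_i lt_j s3 => n; lia.
- by rewrite adj_sym adj_lt ?lt_ji //; move: (size s) lt_i lt_j s3 => n; lia.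
- by rewrite adj_irrefl; move: (size s) lt_i lt_j s3 => n; lia.
Qed.

(** * The Wiener index of a vertex-deleted subgraph *)

Lemma dist_gdist (G : sgraph) (x y : G) :
  dist x y =
    if connect (@adj G) x y then (Posz (gdist (@adj G) x y))%:E else +oo%E.
Proof.
rewrite /dist; case: {-}_ / idP => [c|/negP/negPf-> //]; rewrite c.
case: ex_minnP => m wm m_min; congr (Posz _)%:E; apply/eqP.
rewrite eqn_leq gdist_walk // andbT m_min //.
by have [p [xp lp _ sp]] := geodesic c; apply/walkP; exists p.
Qed.

Lemma wiener_finite (G : sgraph) : (forall x y : G, connect (@adj G) x y) ->
  exists2 m : nat, wiener G = (Posz m)%:E &
                   \sum_(x : G) \sum_(y : G) gdist (@adj G) x y = m.*2.
Proof.
move=> conn; exists (\sum_(x : G) \sum_(y : G | enum_rank x < enum_rank y)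
                      gdist (@adj G) x y).
  rewrite /wiener (big_morph Posz PoszD (erefl (Posz 0))) -sumEFin.
  apply: eq_bigr => x _.
  rewrite (big_morph Posz PoszD (erefl (Posz 0))) -sumEFin.
  by apply: eq_bigr => y _; rewrite dist_gdist conn.
have rank_inj : injective (fun x : G => val (enum_rank x)).
  exact: inj_comp val_inj enum_rank_inj.
exact: double_sum_pairs (gdist_sym (@adj_sym G)) (gdist0 _) _ rank_inj.
Qed.

(** No term is -oo, so a single infinite distance makes the sum infinite.  The
    sum only contains one of the two orders of a pair, hence the reduction to
    enum_rank x < enum_rank y. *)
Lemma wiener_infinite (G : sgraph) (x y : G) :
  ~~ connect (@adj G) x y -> wiener G = +oo%E.
Proof.
wlog lt_xy : x y / enum_rank x < enum_rank y => [IH|] nc.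
  case: (ltngtP (enum_rank x) (enum_rank y))
    => [lt|gt|/val_inj/enum_rank_inj exy].
  - exact: IH lt nc.
  - by apply: IH gt _; rewrite (sym_connect_sym (@adj_sym G)).
  - by rewrite exy connect0 in nc.
have dist_ge0 (a b : G) : (0%E <= dist a b)%O.
  by rewrite dist_gdist; case: ifP.
have ninfty (t : \bar int) : (0%E <= t)%O -> t != -oo%E by case: t.
have sum_ge0 (a : G) :
    (0%E <= \sum_(b : G | (enum_rank a < enum_rank b)%N) dist a b)%E.
  by apply: sume_ge0.
apply/eqP; rewrite /wiener esum_eqy => [|a _]; last exact/ninfty.
apply/existsP; exists x => /=; rewrite esum_eqy => [|b _]; last exact/ninfty.
by apply/existsP; exists y; rewrite dist_gdist (negPf nc) eqxx andbT.
Qed.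

Section DelVertex.
Variables (G : sgraph) (v : G).
Let e' := @adj (del_vertex v).

Lemma del_vertex_to (x y : del_vertex v) : connect e' x y ->
  connect (del (@adj G) v) (val x) (val y) /\
  gdist (del (@adj G) v) (val x) (val y) <= gdist e' x y.
Proof.
apply: gdist_map => a b; rewrite /e' /= => ab; right.
by rewrite /del /= ab (valP a) (valP b).
Qed.

Lemma del_vertex_from (x y : del_vertex v) :
    connect (del (@adj G) v) (val x) (val y) ->
  connect e' x y /\ gdist e' x y <= gdist (del (@adj G) v) (val x) (val y).
Proof.
move=> c; have := @gdist_map G (del_vertex v) _ e' (insubd x) _ _ _ c.
(* Both ends of an edge of del differ from v, so insubd inverts val there. *)
rewrite !valKd; apply=> a b /and3P[ab av bv]; right.
by rewrite /e' /= !insubdK.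
Qed.

Lemma wiener_del_noncut : noncut (@adj G) v ->
  exists2 m : nat, wiener (del_vertex v) = (Posz m)%:E &
                   double_wiener_del (@adj G) v = m.*2.
Proof.
move=> nc; have conn (x y : del_vertex v) : connect e' x y.
  by case: (del_vertex_from (nc _ _ (valP x) (valP y))).
have [m -> eqm] := wiener_finite conn; exists m => //.
rewrite -{}eqm /double_wiener_del (big_sub (fun x => x != v)).
apply: eq_bigr => x _.
rewrite (big_sub (fun y => y != v)); apply: eq_bigr => y _.
apply/eqP; rewrite eqn_leq.
have [c ->] := del_vertex_to (conn x y).
by have [_ ->] := del_vertex_from c.
Qed.

Lemma noncut_wiener_finite :
  wiener (del_vertex v) != +oo%E -> noncut (@adj G) v.
Proof.
move=> fin x y xv yv; pose x' : del_vertex v := Sub x xv.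
pose y' : del_vertex v := Sub y yv.
have [//|nc] := boolP (connect e' x' y'); first by case/del_vertex_to.
by rewrite (wiener_infinite nc) in fin.
Qed.

End DelVertex.

(** The default value #|G| of the minimum is larger than every degree, so it is
    never the minimum of a nonempty list of degrees. *)
Lemma min_degree_attained (G : sgraph) : 0 < #|G| ->
  exists v : G, degree v = min_degree G.
Proof.
have deg_lt (x : G) : degree x < #|G|.
  apply: (@leq_trans #|[set: G]|); last by rewrite cardsT.
  apply/proper_card/properP; split; first exact: subsetT.
  by exists x; rewrite ?inE ?adj_irrefl.
case/card_gt0P=> x0 _; have : index_enum G != [::].
  by apply: contraTneq (mem_index_enum x0) => ->.
rewrite /min_degree.
elim: (index_enum G) => // x [|y r] IHr _; rewrite big_cons.
  by exists x; rewrite big_nil; apply/esym/minn_idPl/ltnW.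
have [v <-] := IHr isT; rewrite /minn.
by case: ifP; [exists x | exists v].
Qed.

Theorem proposition3 (G : sgraph) (G_conn : is_connected G)
    (G_mindeg : min_degree G = 2)
    (G_wiener : forall u v : G,
       wiener (del_vertex u) = wiener (del_vertex v)) :
  is_cycle G.
Proof.
have [G_gt0 conn] := G_conn.
have [v] := min_degree_attained G_gt0; rewrite G_mindeg.
case/eqP/cards2P=> [u [w [uw Nv]]].
have ev y : adj v y = (y == u) || (y == w).
  by move/setP/(_ y): Nv; rewrite !inE.
have nv y : adj v y -> y != v by apply: contraTneq => ->; rewrite adj_irrefl.
have uv : u != v by rewrite nv // ev eqxx.
have wv : w != v by rewrite nv // ev eqxx orbT.
have [z nc_z] := noncut_exists (@adj_sym G) (ex_intro _ u uv) conn.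
have nc x : noncut (@adj G) x.
  apply: noncut_wiener_finite; rewrite (G_wiener x z).
  by have [m ->] := wiener_del_noncut nc_z.
have eqW x y : double_wiener_del (@adj G) x = double_wiener_del (@adj G) y.
  have [m eqm ->] := wiener_del_noncut (nc x).
  have [k eqk ->] := wiener_del_noncut (nc y).
  by have := G_wiener x y; rewrite eqm eqk => -[->].
have wu : w != u by rewrite eq_sym.
apply: (far_apart_cycle uv wv wu ev (nc v)).
exact: (nbrs_far_apart (@adj_sym G) uv wv wu ev nc eqW).
Qed.
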